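(* Let $X$ and $Y$ be real normed spaces with $X$ smooth, and let $f: X \rightarrow Y$ be a surjective phase-isometry. Then $f$ is phase equivalent to a linear isometry.
   Context: A mapping $f: X\to Y$ between real normed spaces is a phase-isometry if $\{\|f(x)+f(y)\|, \|f(x)-f(y)\|\}=\{\|x+y\|, \|x-y\|\}$ (equality of unordered pairs) for all $x,y\in X$. No continuity or linearity is assumed. A mapping $f:X\to Y$ is phase equivalent to a linear isometry if there exists a function $\varepsilon: X\to\{-1,1\}$ such that the map $x\mapsto \varepsilon(x)f(x)$ is a linear isometry. For $0\neq x\in X$, a supporting functional at $x$ is a functional $x^*\in X^*$ with $\|x^*\|=1$ and $x^*(x)=\|x\|$. The space $X$ is smooth if every nonzero $x\in X$ has exactly one supporting functional. *)

(* Defs.v *)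
From mathcomp Require Import all_boot all_order all_algebra.
From mathcomp Require Import all_classical reals topology normedtype.

Set Implicit Arguments.
Unset Strict Implicit.
Unset Printing Implicit Defensive.

Import Order.TTheory GRing.Theory Num.Theory.
Import numFieldNormedType.Exports.

Local Open Scope classical_set_scope.
Local Open Scope ring_scope.

(* For two-element sets [set a; b] = [set c; d] says exactly that {a, b} and
   {c, d} agree as unordered pairs, degenerate pairs included. *)
Definition phase_isometry (R : realType) (X Y : normedModType R)
    (f : X -> Y) : Prop :=
  forall x y : X,
    [set `|f x + f y|; `|f x - f y|] = [set `|x + y|; `|x - y|].

Definition linear_isometry (R : realType) (X Y : normedModType R)
    (T : X -> Y) : Prop :=
  linear T /\ forall x y : X, `|T x - T y| = `|x - y|.

Definition phase_equivalent_to_linear_isometry (R : realType)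
    (X Y : normedModType R) (f : X -> Y) : Prop :=
  exists eps : X -> R,
    (forall x, eps x = -1 \/ eps x = 1) /\
    linear_isometry (fun x => eps x *: f x).

Definition dual (R : realType) (X : normedModType R) : set (X -> R) :=
  [set phi : X -> R | scalar phi /\ continuous phi].
Arguments dual {R} X _.

(* Only meaningful for phi in the dual: sup is 0 on unbounded sets. *)
Definition dual_norm (R : realType) (X : normedModType R) (phi : X -> R) : R :=
  sup [set `|phi x| | x in [set x : X | `|x| <= 1]].

Definition supporting_functional (R : realType) (X : normedModType R)
    (x : X) (phi : X -> R) : Prop :=
  [/\ dual X phi, dual_norm phi = 1 & phi x = `|x|].

Definition smooth (R : realType) (X : normedModType R) : Prop :=
  forall x : X, x != 0 -> exists! phi : X -> R, supporting_functional x phi.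

(* Main.v *)
Require Import Defs.
From mathcomp Require Import all_boot all_order all_algebra.
From mathcomp Require Import all_classical reals topology normedtype.
From mathcomp Require Import derive ring lra.

(** Let [phi_x] be the supporting functional at [x].  By Hahn-Banach, smoothness
    gives [|n x + u| - n |x| --> phi_x u] for all [u].  Since [f] is a
    phase-isometry, [|f (n x) + f u| - n |x|] is close to [phi_x u] or to
    [phi_x (- u)] for each large [n]; its limit along an ultrafilter, as a function
    of [f u], is odd and convex, hence a linear functional [g_x] on [Y] with
    [g_x (f u) = +- phi_x u].
    Thus [f z = s f u + t f v] forces [phi_x z = +- s phi_x u +- t phi_x v] for
    every [x], with signs that depend on [x].  Finitely many nonzero vectors
    admit a common [x] with [phi_x] nonzero on all of them: [x] maximises
    [psi / |.|] on their span for a functional [psi] that vanishes at none of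
    them.  Hence one of the four vectors [z - (+- s u +- t v)] is zero.
    So [f] is additive and homogeneous up to signs, and fixing one [x] the signs
    are chosen by [g_x (F u) = phi_x u]; the vectors with [phi_x u = 0] are
    reached by translation along [x]. *)

Local Open Scope classical_set_scope.
Local Open Scope ring_scope.

Import Order.TTheory GRing.Theory Num.Theory.
Import numFieldNormedType.Exports.

(** * Sublinear functionals and the Hahn-Banach theorem *)

Section Sublinear.
Context {R : realType} {V : lmodType R}.
Implicit Types (p q : V -> R) (h u v : V).

Definition sublinear q :=
  (forall u v, q (u + v) <= q u + q v) /\
  (forall t u, 0 <= t -> q (t *: u) = t * q u).

Lemma sublinear0 q : sublinear q -> q 0 = 0.
Proof. by case=> _ /(_ 0 0 (lexx 0)); rewrite scaler0 mul0r. Qed.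

Lemma sublinearN q v : sublinear q -> - q (- v) <= q v.
Proof.
move=> sq; have [subq _] := sq; have := subq v (- v).
by rewrite subrr (sublinear0 q) // -lerBlDr sub0r.
Qed.

Lemma sublinear_intro q :
  (forall u v, q (u + v) <= q u + q v) -> q 0 = 0 ->
  (forall t u, 0 < t -> q (t *: u) <= t * q u) -> sublinear q.
Proof.
move=> subq q0 homq; split=> // t u; rewrite le_eqVlt => /predU1P[<-|t0].
  by rewrite scale0r mul0r.
apply/eqP; rewrite eq_le homq//= -ler_pdivlMl//.
rewrite -{1}[u](scalerK (lt0r_neq0 t0)); apply: homq.
by rewrite invr_gt0.
Qed.

(** For sublinear [q] the expression is nonincreasing in [t], so the infimum is its limit at
    infinity: the one-sided derivative of [q] at [h] in the direction [v]. *)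
Definition dirinf h q v :=
  inf [set q (v + t *: h) - t * q h | t in [set t | 0 <= t]].

Lemma dirinf_lb h q v : sublinear q ->
  has_lbound [set q (v + t *: h) - t * q h | t in [set t | 0 <= t]].
Proof.
move=> [subq homq]; exists (- q (- v)) => _ [t /= t0 <-].
have := subq (v + t *: h) (- v); rewrite addrAC subrr add0r homq//.
by lra.
Qed.

Lemma dirinf_le h q v t : sublinear q -> 0 <= t ->
  dirinf h q v <= q (v + t *: h) - t * q h.
Proof. by move=> sq t0; apply: ge_inf; [exact: dirinf_lb|exists t]. Qed.

Lemma dirinf_ge h q v c :
  (forall t, 0 <= t -> c <= q (v + t *: h) - t * q h) -> c <= dirinf h q v.
Proof.
move=> cq; apply: lb_le_inf => [|_ [t /= t0 <-]]; last exact: cq.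
by exists (q (v + 0 *: h) - 0 * q h), 0 => /=.
Qed.

Lemma dirinf_le_self h q v : sublinear q -> dirinf h q v <= q v.
Proof.
move=> sq; have := dirinf_le h _ v _ sq (lexx 0).
by rewrite scale0r mul0r addr0 subr0.
Qed.

Lemma dirinfN h q : sublinear q -> dirinf h q (- h) <= - q h.
Proof.
move=> sq; have := dirinf_le h _ (- h) _ sq ler01.
by rewrite scale1r addNr sublinear0// mul1r sub0r.
Qed.

(** Parameters [s] for [u] and [t] for [v] combine to [s + t] for [u + v]; a parameter [s] for [u]
    becomes [t * s] for [t *: u]. *)
Lemma sublinear_dirinf h q : sublinear q -> sublinear (dirinf h q).
Proof.
move=> sq; have [subq homq] := sq; apply: sublinear_intro => [u v||t u t0].
- rewrite -lerBlDr; apply: dirinf_ge => s s0.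
  rewrite lerBlDr [leRHS]addrC -lerBlDr; apply: dirinf_ge => t t0.
  have := dirinf_le h _ (u + v) _ sq (addr_ge0 s0 t0).
  have := subq (u + s *: h) (v + t *: h).
  by rewrite addrACA -scalerDl; lra.
- apply/eqP; rewrite eq_le; apply/andP; split.
    by have := dirinf_le_self h q 0 sq; rewrite (sublinear0 q sq).
  by apply: dirinf_ge => t t0; rewrite add0r homq// subrr.
- rewrite -ler_pdivrMl//; apply: dirinf_ge => s s0.
  rewrite ler_pdivrMl//.
  apply: le_trans (dirinf_le h q (t *: u) (t * s) sq (mulr_ge0 (ltW t0) s0)) _.
  by rewrite -scalerA -scalerDr homq ?(ltW t0)// mulrBr mulrA.
Qed.

Lemma sublinear_odd_scalar q :
  sublinear q -> (forall u, q (- u) <= - q u) -> scalar q.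
Proof.
move=> sq; have [subq homq] := sq => qN.
have {qN} qN u : q (- u) = - q u.
  by apply/eqP; rewrite eq_le qN//= lerNl sublinearN.
have qD u v : q (u + v) = q u + q v.
  apply/eqP; rewrite eq_le subq/=.
  by have := subq (- u) (- v); rewrite -opprD !qN; lra.
move=> a u v; rewrite qD; congr (_ + _).
have [a0|a0] := leP 0 a; first exact: homq.
by rewrite -[a]opprK scaleNr qN homq ?mulNr// oppr_ge0 ltW.
Qed.

(** The witness is the pointwise infimum, bounded below at [v] by [- p (- v)]. Of two comparable
    members, the smaller one gives subadditivity. *)
Lemma sublinear_chain_inf p (A : set (V -> R)) q0 :
  A q0 -> (forall q, A q -> sublinear q /\ forall v, q v <= p v) ->
  (forall q r, A q -> A r -> (forall v, r v <= q v) \/ (forall v, q v <= r v)) ->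
  exists2 m, sublinear m & forall q, A q -> forall v, m v <= q v.
Proof.
move=> Aq0 subA totA; pose m v := inf [set q v | q in A].
have m_le q v : A q -> m v <= q v.
  move=> Aq; apply: ge_inf; last by exists q.
  exists (- p (- v)) => _ [r Ar <-]; have [sr rp] := subA _ Ar.
  by apply: le_trans (sublinearN _ v sr); rewrite lerN2.
have m_ge c v : (forall q, A q -> c <= q v) -> c <= m v.
  by move=> cA; apply: lb_le_inf => [|_ [q Aq <-]]; [exists (q0 v), q0|exact: cA].
exists m => [|q Aq v]; last exact: m_le.
apply: sublinear_intro => [u v||t u t0].
- rewrite -lerBlDr; apply: (m_ge _) => q Aq.
  rewrite lerBlDr [leRHS]addrC -lerBlDr; apply: m_ge => r Ar.
  have [[subq _] _] := subA _ Aq; have [[subr _] _] := subA _ Ar.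
  have [rq|qr] := totA _ _ Aq Ar.
    by have := m_le _ (u + v) Ar; have := subr u v; have := rq u; lra.
  by have := m_le _ (u + v) Aq; have := subq u v; have := qr v; lra.
- apply/eqP; rewrite eq_le; apply/andP; split.
    by have [/sublinear0 <- _] := subA _ Aq0; exact: m_le.
  by apply: m_ge => q /subA[/sublinear0 ->].
- rewrite -ler_pdivrMl//; apply: m_ge => q Aq; rewrite ler_pdivrMl//.
  by have [[_ homq] _] := subA _ Aq; rewrite -(homq _ _ (ltW t0)); exact: m_le.
Qed.

(** A minimal sublinear [q] below [p] is linear: [dirinf h q] is sublinear and below [q], hence
    equal to [q], and its value at [- h] is at most [- q h]. *)
Theorem hahn_banach p : sublinear p ->
  exists2 l : V -> R, scalar l & forall v, l v <= p v.
Proof.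
move=> sp.
pose T := {q : V -> R | sublinear q /\ forall v, q v <= p v}.
(* The order is reversed, so that a maximal element in the sense of [Zorn] is a pointwise minimal
   functional. *)
pose below (q r : T) := `[< forall v, sval r v <= sval q v >].
have [|q r s /asboolP qr /asboolP rs|q r /asboolP qr /asboolP rq|A totA|] :=
    @Zorn T below.
- by move=> q; apply/asboolP.
- by apply/asboolP => v; exact: le_trans (rs v) (qr v).
- move: q r qr rq => [q qP] [r rP] /= qr rq.
  by apply: eq_exist; apply/funext => v; apply/eqP; rewrite eq_le rq qr.
- have [[q0 Aq0]|/forallNP A0] := pselect (exists q : T, A q); last first.
    by exists (exist _ p (conj sp (fun v => lexx (p v)))) => ? /A0.
  have [|_ [q _ <-]|_ _ [q Aq <-] [r Ar <-]|m sm mA] :=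
      @sublinear_chain_inf p [set sval (q : T) | q in A] (sval q0).
  + by exists q0.
  + exact: (svalP q).
  + by have [/asboolP|/asboolP] := totA _ _ Aq Ar; [left|right].
  have mp v : m v <= p v.
    by apply: le_trans (mA (sval q0) _ v) ((svalP q0).2 v); exists q0.
  exists (exist _ m (conj sm mp)) => q Aq; apply/asboolP => v /=.
  by apply: mA; exists q.
move=> [q [sq qp]] minq; exists q => //; apply: sublinear_odd_scalar => // h.
have dp v : dirinf h q v <= p v.
  exact: le_trans (dirinf_le_self _ _ _ sq) (qp v).
pose d : T := exist _ (dirinf h q) (conj (sublinear_dirinf h _ sq) dp).
have /(congr1 sval)/= dq : d = exist _ q (conj sq qp).
  by apply: minq; apply/asboolP => v; exact: dirinf_le_self.
by rewrite -[X in X (- h)]dq dirinfN.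
Qed.

End Sublinear.

(** * Computation rules for linear functionals *)

Section ScalarTheory.
Context {R : realType} {V : lmodType R} {l : V -> R} (lin_l : scalar l).

Lemma functional0 : l 0 = 0.
Proof. by have := lin_l (-1) 0 0; rewrite scaler0 addr0 mulN1r addNr. Qed.

Lemma functionalD u v : l (u + v) = l u + l v.
Proof. by have := lin_l 1 u v; rewrite scale1r mul1r. Qed.

Lemma functionalZ a u : l (a *: u) = a * l u.
Proof. by have := lin_l a u 0; rewrite !addr0 functional0 addr0. Qed.

Lemma functionalN u : l (- u) = - l u.
Proof. by rewrite -scaleN1r functionalZ mulN1r. Qed.

Lemma functionalB u v : l (u - v) = l u - l v.
Proof. by rewrite functionalD functionalN. Qed.

End ScalarTheory.

(** * Supporting functionals and the growth of the norm along rays *)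

Section SupportingFunctional.
Context {R : realType} {X : normedModType R}.
Implicit Types (x u v : X) (phi : X -> R).

(** Trades continuity and the dual norm for one-sided domination by the norm, the form that
    Hahn-Banach delivers. Domination at [v] and [- v] bounds the absolute value of [phi v]. *)
Lemma supporting_functionalP x phi : x != 0 ->
  supporting_functional x phi <->
  [/\ scalar phi, forall v, phi v <= `|v| & phi x = `|x|].
Proof.
move=> x0; have nx0 : 0 < `|x| by rewrite normr_gt0.
split=> [[[lin_phi _] norm_phi phix]|[lin_phi le_phi phix]].
  split=> // v; have [->|v0] := eqVneq v 0; first by rewrite functional0 // normr0.
  have nv0 : 0 < `|v| by rewrite normr_gt0.
  have : `|phi (`|v|^-1 *: v)| <= 1.
    rewrite -norm_phi; apply: ub_le_sup.
      (* Without a genuine supremum, [sup] would be 0 by default, but the dual norm is 1. *)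
      have [//|/sup_out sup0] :=
          pselect (has_sup [set `|phi x| | x in [set x : X | `|x| <= 1]]).
        by case.
      by move: norm_phi; rewrite /dual_norm sup0 => /eqP; rewrite eq_sym oner_eq0.
    exists (`|v|^-1 *: v) => //=.
    by rewrite normrZ normfV normr_id mulVf// normr_eq0.
  rewrite functionalZ// normrM normfV normr_id ler_pdivrMl// mulr1.
  exact: le_trans (ler_norm _).
have abs_phi v : `|phi v| <= `|v|.
  by rewrite ler_norml le_phi andbT lerNl -functionalN// -normrN le_phi.
split=> //; last first.
  apply/eqP; rewrite eq_le; apply/andP; split.
    apply: ge_sup => [|_ [v /= v1 <-]]; last exact: le_trans (abs_phi v) v1.
    by exists `|phi 0|, 0 => //=; rewrite normr0.
  apply: ub_le_sup; first by exists 1 => _ [v /= v1 <-]; exact: le_trans (abs_phi v) v1.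
  exists (`|x|^-1 *: x) => /=.
    by rewrite normrZ normfV normr_id mulVf// normr_eq0.
  by rewrite functionalZ// phix mulVf ?normr1// normr_eq0.
split=> // v; apply/cvgrPdist_le => e e0; near=> w.
rewrite -functionalB//; apply: le_trans (abs_phi _) _.
near: w; exact: cvgr_dist_le.
Unshelve. all: by end_near. Qed.

Lemma sublinear_norm : sublinear (fun v : X => `|v|).
Proof. by split=> [u v|t u t0]; [exact: ler_normD|rewrite normrZ ger0_norm]. Qed.

(** Hahn-Banach below [dirinf u q] gives a linear [l] below [q] with [l u = q u]. Since [q] is below
    the norm and [q (- x) <= - |x|], this [l] supports at [x], and uniqueness makes it [phi]. *)
Lemma smooth_dirinf x phi u : smooth X -> x != 0 -> supporting_functional x phi ->
  phi u = dirinf x (fun v => `|v|) u.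
Proof.
move=> smoothX x0 sphi; pose q := dirinf x (fun v => `|v|).
have sq : sublinear q := sublinear_dirinf x _ sublinear_norm.
have [l lin_l le_l] := hahn_banach _ (sublinear_dirinf u _ sq).
have lu : q u <= l u.
  by rewrite -lerN2 -functionalN//; apply: le_trans (le_l _) (dirinfN _ _ sq).
have {}le_l v : l v <= q v := le_trans (le_l v) (dirinf_le_self _ _ _ sq).
have le_norm v : l v <= `|v| := le_trans (le_l v) (dirinf_le_self x _ v sublinear_norm).
have lx : l x = `|x|.
  apply/eqP; rewrite eq_le le_norm/= -lerN2 -functionalN//.
  exact: le_trans (le_l _) (dirinfN _ _ sublinear_norm).
have sl : supporting_functional x l by apply/supporting_functionalP.
have [psi [_ psi_uniq]] := smoothX x x0.
rewrite -(psi_uniq _ sphi) (psi_uniq _ sl).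
by apply/eqP; rewrite eq_le le_l.
Qed.

(** From below, the norm dominates [phi]. From above, a parameter [t] nearly attaining the infimum
    in [dirinf] serves for every [n >= t] by the triangle inequality. *)
Lemma smooth_ray_cvg x phi u : smooth X -> x != 0 -> supporting_functional x phi ->
  (fun n : nat => `|n%:R *: x + u| - n%:R * `|x|) @ \oo --> phi u.
Proof.
move=> smoothX x0 sphi; have phiu := smooth_dirinf x phi u smoothX x0 sphi.
have [lin_phi le_phi phix] := (supporting_functionalP x phi x0).1 sphi.
have nx0 : 0 < `|x| by rewrite normr_gt0.
apply/cvgrPdist_le => e e0.
have : dirinf x (fun v => `|v|) u < phi u + e by rewrite -phiu ltrDl.
move/inf_lt => [|_ [t /= t0 <-] te].
  by exists (`|u + 0 *: x| - 0 * `|x|), 0 => /=.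
near=> n; rewrite distrC ger0_norm.
  have tn : t <= n%:R by near: n; exact: nbhs_infty_ger.
  have -> : n%:R *: x + u = (u + t *: x) + (n%:R - t) *: x.
    by rewrite scalerBl addrAC addrA subrK addrC.
  have := ler_normD (u + t *: x) ((n%:R - t) *: x).
  rewrite normrZ ger0_norm ?subr_ge0//; nra.
have := le_phi (n%:R *: x + u); rewrite functionalD// functionalZ// phix; lra.
Unshelve. all: by end_near. Qed.

End SupportingFunctional.

(** * Supporting functionals that vanish at none of finitely many vectors *)

Section Covering.
Context {R : realType} {X : normedModType R}.
Implicit Types (psi : X -> R).

Definition comb {k : nat} (b : 'I_k -> X) (s : 'I_k -> R) := \sum_i s i *: b i.

Lemma combZ k (b : 'I_k -> X) a s : comb b (fun i => a * s i) = a *: comb b s.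
Proof. by rewrite /comb scaler_sumr; apply: eq_bigr => i _; rewrite scalerA. Qed.

Lemma comb_lift k (b : 'I_k.+1 -> X) j s :
  comb b s = s j *: b j + comb (b \o lift j) (s \o lift j).
Proof. by rewrite /comb (bigD1_ord j). Qed.

Lemma comb_drop k (b : 'I_k.+1 -> X) j s : comb b s = 0 -> s j != 0 ->
  forall t, exists t', comb b t = comb (b \o lift j) t'.
Proof.
move=> bs0 sj0 t; exists (fun i => t (lift j i) - t j / s j * s (lift j i)).
have -> : comb b t = comb b (fun i => t i - t j / s j * s i).
  rewrite -[LHS]subr0 -(scaler0 _ (t j / s j)) -bs0 /comb scaler_sumr -sumrB.
  by apply: eq_bigr => i _; rewrite scalerBl scalerA.
by rewrite (comb_lift _ _ j) divfK// subrr scale0r add0r.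
Qed.

Lemma comb_extend k (b : 'I_k.+1 -> X) j t' :
  exists t, comb (b \o lift j) t' = comb b t.
Proof.
exists (fun i => oapp t' 0 (unlift j i)).
rewrite (comb_lift _ _ j) unlift_none/= scale0r add0r.
by apply: eq_bigr => i _ /=; rewrite liftK.
Qed.

Lemma comb_continuous k (b : 'I_k -> X) :
  continuous (fun s : 'rV[R]_k => comb b (s ord0)).
Proof.
move=> s; apply: (@cvg_big X _ _ _ _ _ _ (nbhs s)) => [|i _].
  exact: add_continuous.
exact: cvgZr_tmp (@coord_continuous R 1 k ord0 i s).
Qed.

Lemma scalar_comb_continuous k (b : 'I_k -> X) psi : scalar psi ->
  continuous (fun s : 'rV[R]_k => psi (comb b (s ord0))).
Proof.
move=> lin_psi.
have -> : (fun s : 'rV[R]_k => psi (comb b (s ord0))) =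
    (fun s => \sum_i s ord0 i * psi (b i)).
  apply/funext => s; rewrite /comb.
  rewrite (big_morph psi (functionalD lin_psi) (functional0 lin_psi)).
  by apply: eq_bigr => i _; rewrite (functionalZ lin_psi).
move=> s; apply: (@cvg_big R _ _ _ _ _ _ (nbhs s)) => [|i _].
  exact: add_continuous.
by apply: cvgM; [exact: coord_continuous|exact: cvg_cst].
Qed.

(** Dependent vectors are discarded by induction on [k]. For independent ones, [psi / |.|] is
    continuous on the compact unit sphere of coefficient vectors and attains its maximum there. *)
Lemma exists_max_ratio k (b : 'I_k -> X) psi : scalar psi ->
  (exists s, 0 < psi (comb b s)) ->
  exists M s, [/\ 0 < M, comb b s != 0, psi (comb b s) = M * `|comb b s| &
    forall t, psi (comb b t) <= M * `|comb b t| ].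
Proof.
move=> lin_psi; elim: k b => [|k IH] b [s0 s0P].
  by move: s0P; rewrite /comb big_ord0 functional0// ltxx.
have [[s [bs0 [j sj0]]]|indep] :=
    pselect (exists s, comb b s = 0 /\ exists j, s j != 0).
  have drop := comb_drop k b j s bs0 sj0.
  have [s0' s0E] := drop s0.
  have [|M [c [M0 c0 cM leM]]] := IH (b \o lift j).
    by exists s0'; rewrite -s0E.
  have [c' cE] := comb_extend k b j c.
  exists M, c'; rewrite -cE; split=> // t.
  by have [t' ->] := drop t; exact: leM.
have comb_neq0 (s : 'rV[R]_k.+1) : s != 0 -> comb b (s ord0) != 0.
  apply: contra_neq => bs0; apply/rowP => i; rewrite mxE.
  apply/eqP/negP => /negP si0.
  by apply: indep; exists (s ord0); split=> //; exists i.
pose ratio (s : 'rV[R]_k.+1) := psi (comb b (s ord0)) / `|comb b (s ord0)|.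
pose S := [set s : 'rV[R]_k.+1 | `|s| = 1].
(* The ratio is invariant under positive scaling, so a maximum on the sphere is global. *)
have normalize s : s != 0 -> S (`|s|^-1 *: s) /\ ratio (`|s|^-1 *: s) = ratio s.
  move=> s_neq0; have ns0 : `|s| != 0 by rewrite normr_eq0.
  split; first by rewrite /S/= normrZ normfV normr_id mulVf.
  have E : comb b ((`|s|^-1 *: s) ord0) = `|s|^-1 *: comb b (s ord0).
    by rewrite -combZ; apply: eq_bigr => i _; rewrite mxE.
  rewrite /ratio E normrZ (functionalZ lin_psi) normfV normr_id -mulf_div.
  rewrite mulfV ?mul1r//.
  by rewrite invr_eq0.
have rowK t : (\row_i t i) ord0 = t :> ('I_k.+1 -> R).
  by apply/funext => i; rewrite mxE.
have row_neq0 t : psi (comb b t) != 0 -> \row_i t i != 0.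
  apply: contra_neq => t0; rewrite -[t]rowK t0.
  by rewrite /comb big1 ?functional0// => i _; rewrite mxE scale0r.
have s0_neq0 := row_neq0 s0 (lt0r_neq0 s0P).
have [|||c] := @compact_EVT_max _ R ratio S.
- by exists (`|\row_i s0 i|^-1 *: \row_i s0 i); exact: (normalize _ _).1.
- apply: bounded_closed_compact.
    by exists 1; split=> // M M1 s /= ->; exact: ltW.
  apply: (@preimage_closed 'rV[R]_k.+1 R Num.norm [set y | y = 1]).
    by move=> s _; exact: norm_continuous.
  exact: closed_eq.
- apply: continuous_in_subspaceT => s; rewrite inE => Ss.
  have bs0 : `|comb b (s ord0)| != 0.
    by rewrite normr_eq0 comb_neq0// -normr_eq0 Ss oner_eq0.
  pose normb (s : 'rV[R]_k.+1) := `|comb b (s ord0)|.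
  have cnorm : {for s, continuous normb}.
    by apply: continuous_comp; [exact: comb_continuous|exact: norm_continuous].
  have cpsi := scalar_comb_continuous _ b psi lin_psi s.
  exact: (continuousM cpsi (@continuousV _ _ normb _ bs0 cnorm)).
rewrite inE => Sc maxc.
have c_neq0 : c != 0 by rewrite -normr_eq0 Sc oner_eq0.
have nbc : 0 < `|comb b (c ord0)| by rewrite normr_gt0 comb_neq0.
have max_ratio s : s != 0 -> ratio s <= ratio c.
  by move=> /normalize[Ss <-]; apply: maxc; rewrite inE.
exists (ratio c), (c ord0); split; rewrite ?comb_neq0//.
- apply: lt_le_trans (max_ratio _ s0_neq0).
  by rewrite /ratio rowK divr_gt0// normr_gt0 -[s0]rowK comb_neq0.
- by rewrite divfK// gt_eqF.
move=> t; have [->|psi_neq0] := eqVneq (psi (comb b t)) 0.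
  rewrite mulr_ge0//; apply: le_trans (max_ratio _ s0_neq0).
  by rewrite /ratio rowK divr_ge0// ltW.
rewrite -ler_pdivrMr.
  by have := max_ratio _ (row_neq0 t psi_neq0); rewrite /ratio rowK.
by rewrite normr_gt0 -[t]rowK comb_neq0// row_neq0.
Qed.

Lemma exists_nonvanishing_functional (s : seq X) : smooth X ->
  {in s, forall a, a != 0} ->
  exists2 psi, scalar psi & {in s, forall a, psi a != 0}.
Proof.
move=> smoothX; elim: s => [_|a s IH s0].
  by exists (fun=> 0) => // c u v; rewrite mulr0 addr0.
have [u us|psi lin_psi psi_neq0] := IH.
  by apply: s0; rewrite inE us orbT.
have a0 : a != 0 by apply: s0; rewrite inE eqxx.
have [phi [sphi _]] := smoothX a a0.
have [lin_phi _ phia] := (supporting_functionalP a phi a0).1 sphi.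
(* If [phi u] is nonzero, a zero of [psi + c * phi] at [u] would force [psi u / phi u = - c], which
   this [c] is too large to allow. If [phi u = 0], then [u] is not [a] and [psi u] is nonzero by
   induction. *)
pose c := 1 + \sum_(u <- a :: s) `|psi u / phi u|.
have bad_lt u : u \in a :: s -> `|psi u / phi u| < c.
  move=> us; rewrite /c (big_rem u)//= addrCA ltrDl.
  by rewrite ltr_pwDl// sumr_ge0.
exists (fun u => psi u + c * phi u) => [d u v|u us].
  by rewrite lin_psi lin_phi; ring.
have [phiu|phiu] := eqVneq (phi u) 0.
  rewrite phiu mulr0 addr0; move: us; rewrite inE => /predU1P[ua|/psi_neq0//].
  by move: phiu; rewrite ua phia => /eqP; rewrite normr_eq0 (negbTE a0).
apply/eqP => psiE; have /lt_eqF := bad_lt _ us.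
have -> : psi u / phi u = - c.
  by apply: (mulIf phiu); rewrite divfK// mulNr; lra.
rewrite normrN ger0_norm ?eqxx//.
by rewrite addr_ge0// sumr_ge0.
Qed.

(** At a maximiser [x] of [psi / |.|] on the span, with maximum [M], every supporting functional
    agrees with [psi / M] on [s]. *)
Lemma exists_common_nonvanishing_support (s : seq X) : smooth X ->
  {in s, forall a, a != 0} -> s != [::] ->
  exists2 x, x != 0 &
    forall phi, supporting_functional x phi -> {in s, forall a, phi a != 0}.
Proof.
move=> smoothX s0 s_neq0.
have [psi lin_psi psi_neq0] := exists_nonvanishing_functional s smoothX s0.
pose b (i : 'I_(size s)) := s`_i.
have in_comb c a : a \in s -> exists t, comb b t = c *: a.
  move=> sa; have ia : (index a s < size s)%N by rewrite index_mem.
  exists (fun i => if i == Ordinal ia then c else 0).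
  rewrite /comb (bigD1 (Ordinal ia))//= eqxx big1 ?addr0 => [|i /negbTE ->].
    by rewrite /b /= nth_index.
  by rewrite scale0r.
have [a sa] : exists a, a \in s.
  by case: s s_neq0 {s0 psi_neq0 b in_comb} => // a s _; exists a; rewrite mem_head.
have [|M [c [M0 x0 psix leM]]] := exists_max_ratio _ b psi lin_psi.
  have [t tE] := in_comb (psi a) a sa; exists t.
  by rewrite tE functionalZ// -expr2 exprn_even_gt0//= psi_neq0.
set x := comb b c in x0 psix; exists x => // phi sphi u us.
have [lin_phi _ phix] := (supporting_functionalP x phi x0).1 sphi.
(* The ray limit turns [psi <= M * |.|] on the span, an equality at [x], into a bound on [phi]; the
   signs [e = 1] and [e = -1] then give equality. *)
have le_phi e : psi (e *: u) / M <= phi (e *: u).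
  apply: (cvgr_to_ge (smooth_ray_cvg x phi (e *: u) smoothX x0 sphi)).
  apply: nearW => n; have [te teE] := in_comb e u us.
  have := leM (fun i => n%:R * c i + te i).
  have -> : comb b (fun i => n%:R * c i + te i) = n%:R *: x + e *: u.
    rewrite -teE -combZ /comb -big_split; apply: eq_bigr => i _ /=.
    by rewrite scalerDl.
  rewrite (functionalD lin_psi) (functionalZ lin_psi) psix ler_pdivrMr//.
  by lra.
have := le_phi (-1); have := le_phi 1.
rewrite !(functionalZ lin_psi) !(functionalZ lin_phi) !mul1r !mulN1r.
rewrite mulNr lerN2 => psi_le psi_ge.
have <- : psi u / M = phi u by apply/eqP; rewrite eq_le psi_le psi_ge.
by rewrite mulf_neq0 ?psi_neq0// invr_eq0 gt_eqF.
Qed.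

End Covering.

Lemma eq_opp0 {R : numFieldType} {V : lmodType R} (v : V) : v = - v -> v = 0.
Proof.
move=> /eqP; rewrite -addr_eq0 -mulr2n -scaler_nat scaler_eq0 pnatr_eq0/=.
by move=> /eqP.
Qed.

(** * Oddness and injectivity of [f], and transfer of supporting functionals to [Y] *)

Section PhaseIsometry.
Context {R : realType} {X Y : normedModType R} {f : X -> Y}.
Hypotheses (surj_f : set_surj [set: X] [set: Y] f) (phase_f : phase_isometry f).
Implicit Types (x y u v : X) (w : Y).

Lemma phase_isometryP x y :
  `|f x + f y| = `|x + y| /\ `|f x - f y| = `|x - y| \/
  `|f x + f y| = `|x - y| /\ `|f x - f y| = `|x + y|.
Proof.
have /seteqP[sub sup] := phase_f x y.
have [] := sub `|f x + f y| (or_introl erefl);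
  have [] := sub `|f x - f y| (or_intror erefl) => /= E1 E2.
(* Both norms of images equal the same member of the pair; the reverse inclusion then makes all four
   norms equal. *)
- have [] := sup `|x - y| (or_intror erefl) => /= E3; left; split=> //; lra.
- by left.
- by right.
- have [] := sup `|x + y| (or_introl erefl) => /= E3; left; split=> //; lra.
Qed.

Lemma phase_isometry_norm x : `|f x| = `|x|.
Proof.
have two (V : normedModType R) (v : V) : `|v + v| = 2 * `|v|.
  by rewrite -mulr2n -scaler_nat normrZ normr_nat.
have := phase_isometryP x x; rewrite !subrr !normr0 !two.
by case=> -[]; lra.
Qed.

Lemma phase_isometry0 : f 0 = 0.
Proof. by apply/eqP; rewrite -normr_eq0 phase_isometry_norm normr0. Qed.

Lemma phase_isometry_eq0 x : f x = 0 -> x = 0.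
Proof. by move=> /eqP; rewrite -normr_eq0 phase_isometry_norm normr_eq0 => /eqP. Qed.

Lemma surj_phase_isometry w : exists u, f u = w.
Proof. by have [u _ <-] := surj_f w I; exists u. Qed.

Lemma phase_isometry_eq_opp x y : `|f x + f y| = 0 \/ `|f x - f y| = 0 ->
  y = x \/ y = - x.
Proof.
suff : `|x + y| = 0 \/ `|x - y| = 0 -> y = x \/ y = - x.
  have [[-> ->]//|[-> ->] xy [|] h] := phase_isometryP x y; apply: xy.
    by right.
  by left.
case=> /eqP; rewrite normr_eq0.
  by rewrite addrC addr_eq0 => /eqP; right.
by rewrite subr_eq0 => /eqP; left.
Qed.

(** A preimage [y] of [- f x] has [|f x + f y| = 0], hence is [x] or [- x]; the case [y = x] forces
    [f x = 0]. *)
Lemma phase_isometryN x : f (- x) = - f x.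
Proof.
have [y yE] := surj_phase_isometry (- f x).
have [yx|<-//] : y = x \/ y = - x.
  by apply: phase_isometry_eq_opp; left; rewrite yE subrr normr0.
suff /phase_isometry_eq0 -> : f x = 0 by rewrite oppr0 phase_isometry0 oppr0.
by apply: eq_opp0; rewrite -yE yx.
Qed.

Lemma phase_isometry_inj : injective f.
Proof.
move=> x y fxy; have [//|yx] : y = x \/ y = - x.
  by apply: phase_isometry_eq_opp; right; rewrite fxy subrr normr0.
have /phase_isometry_eq0 x0 : f x = 0.
  by apply: eq_opp0; rewrite -phase_isometryN -yx.
by rewrite yx x0 oppr0.
Qed.

Lemma exists_dual_functional x phi : smooth X -> x != 0 ->
  supporting_functional x phi ->
  exists2 g : Y -> R, scalar g & forall u, g (f u) = phi u \/ g (f u) = - phi u.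
Proof.
move=> smoothX x0 sphi.
have [lin_phi le_phi phix] := (supporting_functionalP x phi x0).1 sphi.
(* The sign relating [f (n x)] and [f u] may vary with [n]; an ultrafilter settles it for each
   [u]. *)
have [U [UU oo_U]] := ultraFilterLemma (eventually_filter : ProperFilter \oo).
pose G w n := `|f (n%:R *: x) + w| - n%:R * `|x|.
have ray u : (fun n : nat => `|n%:R *: x + u| - n%:R * `|x|) @ U --> phi u.
  move=> A nA; apply: oo_U.
  exact: (smooth_ray_cvg x phi u smoothX x0 sphi A nA).
have /choice[g gP] w : exists c, [/\ G w n @[n --> U] --> c,
    G (- w) n @[n --> U] --> - c & forall u, f u = w -> c = phi u \/ c = - phi u].
  have [u <-] := surj_phase_isometry w.
  (* On [A] the two norms keep their order, off [A] they are swapped. In either case the limits for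
     [f u] and [- f u] are opposite. *)
  pose A := [set n : nat | `|f (n%:R *: x) + f u| = `|n%:R *: x + u| /\
                           `|f (n%:R *: x) - f u| = `|n%:R *: x - u|].
  have [UA|UA] := in_ultra_setVsetC A UU.
    exists (phi u); split.
    - apply: cvg_trans (ray u); apply: near_eq_cvg.
      by near=> n; rewrite /G; have [->] : A n by near: n.
    - rewrite -functionalN//.
      apply: cvg_trans (ray (- u)); apply: near_eq_cvg.
      by near=> n; rewrite /G; have [_ ->] : A n by near: n.
    - by move=> v /phase_isometry_inj ->; left.
  exists (- phi u); split.
  - rewrite -functionalN//; apply: cvg_trans (ray (- u)); apply: near_eq_cvg.
    near=> n; rewrite /G; have nA : ~ A n by near: n.
    by have [/nA//|[->]] := phase_isometryP (n%:R *: x) u.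
  - rewrite opprK; apply: cvg_trans (ray u); apply: near_eq_cvg.
    near=> n; rewrite /G; have nA : ~ A n by near: n.
    by have [/nA//|[_ ->]] := phase_isometryP (n%:R *: x) u.
  - by move=> v /phase_isometry_inj ->; right.
have gE w c : G w n @[n --> U] --> c -> g w = c.
  by have [cw _ _] := gP w => cw'; apply: cvg_unique cw cw'.
have gN w : g (- w) = - g w by apply: gE; have [] := gP w.
have g0 : g 0 = 0 by have := gN 0; rewrite oppr0; lra.
(* The common base point [f (n x)] and the subtracted [n |x|] both split with weights [t] and
   [1 - t], so convexity of the norm passes to the limit. *)
have g_convex t w w' : 0 <= t <= 1 ->
    g (t *: w + (1 - t) *: w') <= t * g w + (1 - t) * g w'.
  move=> /andP[t0 t1]; have [cw _ _] := gP w; have [cw' _ _] := gP w'.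
  have [cs _ _] := gP (t *: w + (1 - t) *: w').
  apply: (ler_cvg_to cs (cvgD (cvgMl_tmp (a := t) cw) (cvgMl_tmp (a := 1 - t) cw'))).
  apply: nearW => n; rewrite fctE /G /=; set z := f _.
  have -> : z + (t *: w + (1 - t) *: w') = t *: (z + w) + (1 - t) *: (z + w').
    by rewrite !scalerDr addrACA -scalerDl subrKC scale1r.
  have := ler_normD (t *: (z + w)) ((1 - t) *: (z + w')).
  by rewrite !normrZ !ger0_norm ?subr_ge0//; lra.
have gZ1 t w : 0 <= t <= 1 -> g (t *: w) = t * g w.
  move=> t01; have := g_convex t w 0 t01; have := g_convex t (- w) 0 t01.
  by rewrite !scaler0 !addr0 scalerN !gN g0; lra.
have gZ t w : 0 < t -> g (t *: w) = t * g w.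
  move=> t0; have [t1|t1] := leP t 1; first by rewrite gZ1// ltW.
  rewrite -{2}[w](scalerK (lt0r_neq0 t0)) (gZ1 t^-1).
    by rewrite mulrA mulfV ?mul1r// lt0r_neq0.
  by rewrite invr_ge0 ltW//= invf_le1// ltW.
have gD w w' : g (w + w') <= g w + g w'.
  have h : 0 <= (2^-1 : R) <= 1 by apply/andP; split; lra.
  have := g_convex 2^-1 w w' h.
  have -> : 1 - 2^-1 = 2^-1 :> R by lra.
  by rewrite -scalerDr gZ1//; lra.
exists g => [|u]; last by have [_ _] := gP (f u); exact.
apply: sublinear_odd_scalar => [|w]; last by rewrite gN.
by apply: sublinear_intro => // t w t0; rewrite gZ.
Unshelve. all: by end_near. Qed.

End PhaseIsometry.

(** * Additivity and homogeneity of [f] up to signs *)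

Section Algebra.
Context {R : realType} {X Y : normedModType R} {f : X -> Y}.
Hypotheses (surj_f : set_surj [set: X] [set: Y] f) (phase_f : phase_isometry f).
Implicit Types (x y u v : X) (w : Y).

(** If all four candidate differences were nonzero, some supporting [phi] would vanish at none of
    them. Applying the associated [g] to the relation in [Y] makes [phi] vanish at one. *)
Lemma phase_isometry_combination z u v s t : smooth X ->
  f z = s *: f u + t *: f v ->
  exists a b : R, [/\ a = 1 \/ a = -1, b = 1 \/ b = -1 &
    z = (a * s) *: u + (b * t) *: v].
Proof.
move=> smoothX fz; apply: contrapT => noab.
have diff_neq0 a b : a = 1 \/ a = -1 -> b = 1 \/ b = -1 ->
    z - ((a * s) *: u + (b * t) *: v) != 0.
  move=> a1 b1; apply/negP; rewrite subr_eq0 => /eqP zE.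
  by apply: noab; exists a, b.
have one : (1 : R) = 1 \/ (1 : R) = -1 by left.
have mone : (-1 : R) = 1 \/ (-1 : R) = -1 by right.
pose d a b := z - ((a * s) *: u + (b * t) *: v).
have [e||x x0 xP] := @exists_common_nonvanishing_support R X
    [:: d 1 1; d 1 (-1); d (-1) 1; d (-1) (-1)] smoothX.
- by rewrite !inE => /or4P[] /eqP ->; exact: diff_neq0.
- by [].
have [phi [sphi _]] := smoothX x x0.
have [lin_phi _ _] := (supporting_functionalP x phi x0).1 sphi.
have [g lin_g gP] := exists_dual_functional surj_f phase_f x phi smoothX x0 sphi.
have phid a b : phi (d a b) = phi z - (a * s * phi u + b * t * phi v).
  by rewrite /d functionalB// functionalD// !(functionalZ lin_phi).
have d_neq0 := xP phi sphi.
have := d_neq0 (d 1 1); have := d_neq0 (d 1 (-1)).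
have := d_neq0 (d (-1) 1); have := d_neq0 (d (-1) (-1)).
rewrite !inE !eqxx !orbT !phid.
move=> /(_ isT)/eqP d1 /(_ isT)/eqP d2 /(_ isT)/eqP d3 /(_ isT)/eqP d4.
have : g (f z) = s * g (f u) + t * g (f v).
  by rewrite fz functionalD// !(functionalZ lin_g).
by case: (gP z) (gP u) (gP v) => -> [] -> [] -> E;
  first [by apply: d1; lra|by apply: d2; lra|by apply: d3; lra|by apply: d4; lra].
Qed.

Lemma phase_isometryZ t u : smooth X ->
  f (t *: u) = t *: f u \/ f (t *: u) = - (t *: f u).
Proof.
move=> smoothX; have [z zE] := surj_phase_isometry surj_f (t *: f u).
have [|a [b [a1 _]]] := @phase_isometry_combination z u u t 0 smoothX.
  by rewrite zE scale0r addr0.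
rewrite mulr0 scale0r addr0; case: a1 => ->; rewrite ?mul1r ?mulN1r => zE'.
  by left; rewrite -zE zE'.
by right; rewrite -zE zE' scaleNr (phase_isometryN surj_f phase_f) opprK.
Qed.

(** Relations are pulled back from [Y] to [X], so one starts from preimages of [f u + f v] and
    [f u - f v]. Each is, up to sign, [u + v] or [u - v], and one equal to [u + v] up to sign
    suffices. *)
Lemma phase_isometryD u v : smooth X ->
  exists a b : R, [/\ a = 1 \/ a = -1, b = 1 \/ b = -1 &
    f (u + v) = a *: f u + b *: f v].
Proof.
move=> smoothX.
have key (e : R) : e = 1 \/ e = -1 ->
    exists (z : X) (c : R), [/\ c = 1 \/ c = -1, f z = f u + e *: f v &
      z = c *: (u + v) \/ z = c *: (u - v)].
  move=> e1; have [z zE] := surj_phase_isometry surj_f (f u + e *: f v).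
  have [|a [b [a1 b1 zab]]] := @phase_isometry_combination z u v 1 e smoothX.
    by rewrite scale1r.
  exists z, a; split=> //; rewrite zab mulr1.
  by case: a1 b1 e1 => -> [] -> [] ->; rewrite ?mul1r ?mulr1 ?mulN1r
    ?opprK ?scaleN1r ?scale1r ?opprD ?opprK; auto.
have fsign (c : R) x : c = 1 \/ c = -1 -> f x = c *: f (c *: x).
  by case=> ->; rewrite ?scaleN1r ?(phase_isometryN surj_f phase_f) ?opprK ?scale1r.
have from_sum (e : R) z (c : R) : e = 1 \/ e = -1 -> c = 1 \/ c = -1 ->
    f z = f u + e *: f v -> z = c *: (u + v) ->
    exists a b : R, [/\ a = 1 \/ a = -1, b = 1 \/ b = -1 &
      f (u + v) = a *: f u + b *: f v].
  move=> e1 c1 fz zE; exists c, (c * e); split=> //.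
    by case: e1 c1 => -> [] ->; rewrite ?mul1r ?mulN1r ?opprK; auto.
  by rewrite -scalerA -scalerDr -fz zE -fsign.
have [|z1 [c1 [c1s fz1 [z1E|z1E]]]] := key 1; first by left.
  by apply: from_sum fz1 z1E => //; left.
have [|z2 [c2 [c2s fz2 [z2E|z2E]]]] := key (-1); first by right.
  by apply: from_sum fz2 z2E => //; right.
(* Both preimages are now [u - v] up to sign, so [f u + f v] and [f u - f v] agree up to sign, which
   forces [v = 0] or [u = 0]. *)
have fz12 : f z1 = f z2 \/ f z1 = - f z2.
  rewrite z1E z2E -!(phase_isometryN surj_f phase_f).
  by case: c1s c2s => -> [] ->; rewrite ?scaleN1r ?scale1r ?opprK; auto.
exists 1, 1; split; [by left|by left|rewrite !scale1r].
move: fz12; rewrite fz1 fz2 scale1r scaleN1r => -[/addrI /eq_opp0|/eqP].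
  move/(phase_isometry_eq0 phase_f) => ->.
  by rewrite (phase_isometry0 phase_f) !addr0.
rewrite opprB [f u + _]addrC => /eqP/addrI/eq_opp0/(phase_isometry_eq0 phase_f) ->.
by rewrite (phase_isometry0 phase_f) add0r addr0.
Qed.

End Algebra.

(** * Global choice of signs and the linear isometry *)

Lemma phase_equivalent_of_linear (R : realType) (X Y : normedModType R)
    (f F : X -> Y) :
  phase_isometry f -> linear F -> (forall u, F u = f u \/ F u = - f u) ->
  phase_equivalent_to_linear_isometry f.
Proof.
move=> phase_f lin_F F_pm.
have /choice[eps epsP] u : exists e : R, (e = -1 \/ e = 1) /\ e *: f u = F u.
  have [->|->] := F_pm u; [exists 1|exists (-1)].
    by rewrite scale1r; split=> //; right.
  by rewrite scaleN1r; split=> //; left.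
exists eps; split=> [u|]; first by have [] := epsP u.
have -> : (fun u => eps u *: f u) = F by apply/funext => u; have [] := epsP u.
split=> // u v.
have -> : F u - F v = F (u - v).
  by rewrite [u - v]addrC -[- v]scaleN1r lin_F scaleN1r addrC.
by have [->|->] := F_pm (u - v); rewrite ?normrN phase_isometry_norm.
Qed.

Theorem theorem2p8 (R : realType) (X Y : normedModType R) (f : X -> Y)
    (smoothX : smooth X)
    (surj_f : set_surj [set: X] [set: Y] f)
    (phase_f : phase_isometry f) :
  phase_equivalent_to_linear_isometry f.
Proof.
have [[x x0]|X0] := pselect (exists x : X, x != 0); last first.
  have f0 u : f u = 0.
    have -> : u = 0 by apply/eqP/negPn/negP => u0; apply: X0; exists u.
    exact: phase_isometry0.
  apply: (@phase_equivalent_of_linear _ _ _ _ f) => // [a u v|u]; last by left.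
  by rewrite !f0 scaler0 addr0.
have [phi [sphi _]] := smoothX x x0.
have [lin_phi _ phix] := (supporting_functionalP x phi x0).1 sphi.
have nx : 0 < `|x| by rewrite normr_gt0.
have [g lin_g gP] := exists_dual_functional surj_f phase_f x phi smoothX x0 sphi.
(* The sign is normalised by [g (F0 u) = phi u], which determines it whenever [phi u] is nonzero. *)
pose F0 u := if g (f u) == phi u then f u else - f u.
have F0_pm u : F0 u = f u \/ F0 u = - f u by rewrite /F0; case: eqP; auto.
have gF0 u : g (F0 u) = phi u.
  rewrite /F0; case: eqP => // gfu; rewrite functionalN//.
  by have [/gfu|->] := gP u; rewrite ?opprK.
have F0_uniq u w : phi u != 0 -> w = f u \/ w = - f u -> g w = phi u -> w = F0 u.
  move=> /eqP phiu wE gw; have := gF0 u.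
  case: (F0_pm u) wE gw => -> [->|->] //; rewrite ?(functionalN lin_g) => E1 E2;
  by exfalso; apply: phiu; lra.
have F0_pmD u v : exists a b : R, [/\ a = 1 \/ a = -1, b = 1 \/ b = -1 &
    F0 (u + v) = a *: F0 u + b *: F0 v].
  have [a [b [a1 b1 fuv]]] := phase_isometryD surj_f phase_f u v smoothX.
  have N1 (c : R) : c = 1 \/ c = -1 -> - c = 1 \/ - c = -1.
    by case=> ->; rewrite ?opprK; auto.
  have pm w : exists c : R, (c = 1 \/ c = -1) /\ f w = c *: F0 w.
    have [->|->] := F0_pm w; first by exists 1; rewrite scale1r; auto.
    by exists (-1); rewrite scaleN1r opprK; auto.
  have [cu [cu1 fu]] := pm u; have [cv [cv1 fv]] := pm v.
  have mul1 (c d : R) : c = 1 \/ c = -1 -> d = 1 \/ d = -1 -> c * d = 1 \/ c * d = -1.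
    by case=> ->; rewrite ?mul1r ?mulN1r//; exact: N1.
  have [->|->] := F0_pm (u + v);
    [exists (a * cu), (b * cv)|exists (- (a * cu)), (- (b * cv))].
    by split; [exact: mul1|exact: mul1|rewrite fuv fu fv !scalerA].
  by split; [exact/N1/mul1|exact/N1/mul1|rewrite fuv fu fv !scalerA opprD !scaleNr].
have F0D u v : phi u != 0 -> phi v != 0 -> phi (u + v) != 0 ->
    F0 (u + v) = F0 u + F0 v.
  move=> /eqP phiu /eqP phiv /eqP phiuv.
  have [a [b [a1 b1 fuv]]] := F0_pmD u v.
  have := gF0 (u + v); rewrite fuv functionalD// !(functionalZ lin_g) !gF0.
  rewrite functionalD// in phiuv *.
  (* Applying [g] gave [phi u + phi v = a * phi u + b * phi v]; each wrong sign pattern kills one of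
     [phi v], [phi u], [phi (u + v)]. *)
  case: a1 b1 {fuv} => -> [] ->; rewrite ?scale1r // => E; exfalso.
  - by apply: phiv; lra.
  - by apply: phiu; lra.
  - by apply: phiuv; lra.
have F0Z t u : phi u != 0 -> t != 0 -> F0 (t *: u) = t *: F0 u.
  move=> phiu t0; apply/esym/F0_uniq.
  - by rewrite functionalZ// mulf_neq0.
  - have [->|->] := phase_isometryZ surj_f phase_f t u smoothX;
      have [->|->] := F0_pm u; rewrite ?scalerN ?opprK; auto.
  - by rewrite !functionalZ// gF0.
have phi_x0 : phi x != 0 by rewrite phix gt_eqF.
have F0_shift u c : phi u != 0 -> phi (u + c *: x) != 0 ->
    F0 (u + c *: x) = F0 u + c *: F0 x.
  have [->|c0] := eqVneq c 0; first by rewrite !scale0r !addr0.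
  move=> phiu phiuc; rewrite F0D ?F0Z//.
  by rewrite functionalZ// mulf_neq0.
(* A vector in the kernel of [phi] is translated by [x] to leave it; other vectors stay put. *)
pose c u : R := if phi u == 0 then 1 else 0.
have phi_c u : phi (u + c u *: x) != 0.
  rewrite /c; have [phiu|phiu] := eqVneq (phi u) 0; last by rewrite scale0r addr0.
  by rewrite scale1r functionalD// phiu add0r.
pose F u := F0 (u + c u *: x) - c u *: F0 x.
have FE u d : phi (u + d *: x) != 0 -> F0 (u + d *: x) = F u + d *: F0 x.
  have -> : u + d *: x = (u + c u *: x) + (d - c u) *: x.
    by rewrite scalerBl addrA addrAC addrK.
  by move=> phid; rewrite F0_shift// /F scalerBl addrA addrAC.
apply: (@phase_equivalent_of_linear _ _ _ _ F) => // [a u v|u]; last first.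
  rewrite /F /c; have [phiu|phiu] := eqVneq (phi u) 0; last first.
    by rewrite !scale0r addr0 subr0.
  (* On the kernel of [phi], applying [g] forces [b = 1], so the contribution of [x] cancels and
     [F u = a *: F0 u]. *)
  have [a [b [a1 b1 F0ux]]] := F0_pmD u x.
  have := gF0 (u + x); rewrite F0ux (functionalD lin_g) (functionalD lin_phi).
  rewrite !(functionalZ lin_g) !gF0 phiu.
  case: b1 F0ux => -> F0ux; last by rewrite phix => ?; exfalso; lra.
  rewrite !scale1r F0ux scale1r addrK => _.
  by case: a1 (F0_pm u) => -> [] ->; rewrite ?scale1r ?scaleN1r ?opprK; auto.
have [->|a0] := eqVneq a 0; first by rewrite !scale0r !add0r.
pose q := phi (a *: u + v) + a * c u * `|x|.
(* A shift large enough that [phi] vanishes neither at [v + d *: x] nor at the shifted sum, where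
   its values are [phi v + d * |x|] and [q + d * |x|]. *)
pose d := (1 + `|phi v| + `|q|) / `|x|.
have dx : d * `|x| = 1 + `|phi v| + `|q| by rewrite divfK// gt_eqF.
have pos r : r = phi v \/ r = q -> r + d * `|x| != 0.
  rewrite dx; have := ler_norm (- phi v); have := ler_norm (- q).
  rewrite !normrN; have := normr_ge0 (phi v); have := normr_ge0 q.
  by move=> ? ? ? ? rE; apply: lt0r_neq0; case: rE => ->; lra.
have phivd : phi (v + d *: x) != 0.
  by rewrite functionalD// functionalZ// phix pos//; left.
have phiuvd : phi (a *: u + v + (a * c u + d) *: x) != 0.
  by rewrite functionalD// (functionalZ lin_phi (_ + d)) phix mulrDl addrA pos//; right.
have := FE _ _ phiuvd.
have E : a *: u + v + (a * c u + d) *: x = a *: (u + c u *: x) + (v + d *: x).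
  by rewrite scalerDr scalerA scalerDl addrACA.
rewrite E in phiuvd *; rewrite F0D// ?(functionalZ lin_phi) ?mulf_neq0// F0Z// FE// FE//.
by rewrite scalerDr scalerA scalerDl addrACA => /addIr.
Qed.
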